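(* Let $d=1$ and let $\nu(x)=c_\mu(1+x^2)^{-(\mu+1)/2}$, $\mu>0$, be the Student density on $\mathbb R$. Let $q\ge0$ and $i\in\{0,\dots,N\}$. Assume that the value function $y_i$ is $r$ times ($r\ge1$) continuously differentiable on $\mathbb R$ and that there is $p\in\mathbb N$ such that $$\limsup_{x\to\pm\infty}\frac{|y_i^{(n)}(x)|}{|x|^{p-n}}<+\infty,\qquad n=0,\dots,r,$$ where $y_i^{(n)}$ denotes the $n$-th derivative. Assume $p+(r-\tfrac12)\mu<q$. Then the coefficients $(\alpha^{(q)}_{i,k})_{k\in\mathbb N}$ satisfy, for every integer $K\ge0$, $$\sum_{k=K+1}^\infty|\alpha^{(q)}_{i,k}|^2\le\frac{C^{(r)}}{(K+1)^{2r}},\qquad\text{where}\quad C^{(r)}:=\frac1{\pi^{2r}}\int_0^1\left|\frac{d^r}{du^r}h^{(q)}_i(u)\right|^2du<+\infty .$$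
   Context: $\mathbb N=\{0,1,\dots\}$; $c_\mu>0$ is the normalizing constant of the density; $F_\nu(x)=\int_{-\infty}^x\nu$ is the CDF and $F_\nu^{-1}:(0,1)\to\mathbb R$ its inverse. The damped function is $x\mapsto y_i(x)/(1+x^2)^{q/2}$, denoted $y^{(q)}_i$ below with parenthesized superscript the real exponent $q$ (not a derivative), and $h^{(q)}_i:=y^{(q)}_i\circ F_\nu^{-1}$ on $(0,1)$. The coefficients are $\alpha^{(q)}_{i,k}:=\int_{\mathbb R}y^{(q)}_i\phi_k\,\nu\,dx$ with $\phi_0\equiv1$ and $\phi_k(x)=\sqrt2\cos(k\pi F_\nu(x))$ for $k\ge1$. Value functions: $T>0$, $N\ge1$, $\Delta=T/N$, $t_j=j\Delta$; $b:[0,T]\times\mathbb R\to\mathbb R$ and $\sigma:[0,T]\times\mathbb R\to\mathbb R^{1\times d_W}$ are bounded measurable; $W$ is a standard $d_W$-dimensional Brownian motion; $X_{j+1}=X_j+b(t_j,X_j)\Delta+\sigma(t_j,X_j)(W_{t_{j+1}}-W_{t_j})$; $g$ is measurable with $|g(x)|\le C_g(1+|x|^2)^{\eta_g/2}$; $f_j(x,y)=f(t_j,x,y)$ is measurable, $|f_j(x,y)-f_j(x,y')|\le L_f|y-y'|$, $|f_j(x,0)|\le C_f(1+|x|^2)^{\eta_f/2}$ (finite nonnegative constants). Then $y_N=g$ and $y_i(x)=\mathbb E[g(X_N)+\sum_{j=i}^{N-1}f_j(X_j,y_{j+1}(X_{j+1}))\Delta\mid X_i=x]$ for $i<N$. 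*)

(* Defs.v *)
Set Warnings "-notation-overridden,-notation-incompatible-prefix,-ambiguous-paths".
From HB Require Import structures.
From mathcomp Require Export all_boot all_order all_algebra.
From mathcomp Require Export all_classical all_reals all_analysis.
Export Order.TTheory GRing.Theory Num.Theory numFieldNormedType.Exports.

Set Implicit Arguments.
Unset Strict Implicit.
Unset Printing Implicit Defensive.

Local Open Scope classical_set_scope.
Local Open Scope ring_scope.

Section StudentBasis.
Context {R : realType}.
Implicit Types (mu q x u : R) (k r : nat).

Definition student_weight mu x : R := (1 + x ^+ 2) `^ (- ((mu + 1) / 2)).

Definition student_const mu : R :=
  (\int[lebesgue_measure]_(x in [set: R]) student_weight mu x)^-1.

Definition student_pdf mu x : R := student_const mu * student_weight mu x.

Definition student_cdf mu x : R :=
  \int[lebesgue_measure]_(z in `]-oo, x]) student_pdf mu z.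

(* Only meaningful on ]0, 1[, the range of the CDF; it is 0 elsewhere. *)
Definition student_cdf_inv mu : R -> R :=
  'pinv_(fun=> 0) [set: R] (student_cdf mu).

Definition phi mu k x : R :=
  if k == 0%N then 1
  else Num.sqrt 2 * cos (k%:R * pi * student_cdf mu x).

Definition damped q (y : R -> R) x : R := y x / (1 + x ^+ 2) `^ (q / 2).

Definition damped_unit mu q (y : R -> R) u : R :=
  damped q y (student_cdf_inv mu u).

Definition coef mu q (y : R -> R) k : R :=
  \int[lebesgue_measure]_(x in [set: R])
    (damped q y x * phi mu k x * student_pdf mu x).

Definition tail_const r (h : R -> R) : \bar R :=
  ((pi ^+ (2 * r))^-1%:E *
   \int[lebesgue_measure]_(u in `]0%R, 1%R[) (`|h^`(r)%classic u| ^+ 2)%:E)%E.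

Definition continuously_differentiable r (y : R -> R) : Prop :=
  (forall n x, (n < r)%N -> derivable y^`(n)%classic x 1) /\ continuous y^`(r)%classic.

End StudentBasis.

Section ValueFunctions.
Context {R : realType} {d : measure_display} {Omega : measurableType d}.
Variable P : probability Omega R.

(* Taking some B i equal to the full set gives the product rule for every
   subfamily. *)
Definition mutually_independent (I : finType) (X : I -> Omega -> R) : Prop :=
  forall B : I -> set R, (forall i, measurable (B i)) ->
    P (\bigcap_(i in [set: I]) (X i @^-1` B i)) =
    (\prod_(i : I) P (X i @^-1` B i))%E.

(* Standard dW-dimensional Brownian motion on [0, T].  The independence clause
   ranges over pairs (time step, coordinate), so it covers both the independent
   increments and the independent coordinates. *)
Record brownian_motion (T : R) (dW : nat) (W : R -> Omega -> 'cV[R]_dW) : Prop :=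
  { bm_measurable : forall t k, 0 <= t <= T ->
      measurable_fun [set: Omega] (fun w => W t w k ord0);
    bm_start : {ae P, forall w, W 0 w = 0};
    bm_independent : forall (n : nat) (s : nat -> R),
      0 <= s 0%N -> s n <= T -> (forall j, (j < n)%N -> s j < s j.+1) ->
      mutually_independent (fun (jk : 'I_n * 'I_dW) w =>
        W (s jk.1.+1) w jk.2 ord0 - W (s jk.1) w jk.2 ord0);
    bm_gaussian : forall (s t : R) (k : 'I_dW) (B : set R),
      0 <= s -> s < t -> t <= T -> measurable B ->
      P [set w | B (W t w k ord0 - W s w k ord0)] =
      normal_prob 0 (Num.sqrt (t - s)) B;
    bm_continuous : {ae P, forall w, forall k,
      {within `[0, T], continuous (fun t => W t w k ord0)}} }.

Definition time_step (T : R) (N : nat) : R := T / N%:R.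
Definition time (T : R) (N j : nat) : R := j%:R * time_step T N.

(* euler ... i x j w is X_j for the scheme started from X_i = x (it is the
   constant x for j <= i). *)
Fixpoint euler (T : R) (N dW : nat) (b : R -> R -> R)
    (sigma : R -> R -> 'rV[R]_dW) (W : R -> Omega -> 'cV[R]_dW)
    (i : nat) (x : R) (j : nat) (w : Omega) : R :=
  if j is j'.+1 then
    let X := euler T N b sigma W i x j' w in
    if (i <= j')%N then
      X + b (time T N j') X * time_step T N
        + (sigma (time T N j') X
             *m (W (time T N j'.+1) w - W (time T N j') w)) ord0 ord0
    else x
  else x.

(* E[ . | X_i = x] is the expectation for the scheme started from x at time
   t_i: by the Markov property this is the regular version of the conditional
   expectation, and it is defined for every x. *)
Definition value_functions (T : R) (N dW : nat) (b : R -> R -> R)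
    (sigma : R -> R -> 'rV[R]_dW) (W : R -> Omega -> 'cV[R]_dW)
    (g : R -> R) (f : R -> R -> R -> R) (y : nat -> R -> R) : Prop :=
  y N = g /\
  forall i x, (i < N)%N ->
    let X := euler T N b sigma W i x in
    (y i x)%:E =
    'E_P[(fun w => g (X N w) +
            \sum_(i <= j < N)
               f (time T N j) (X j w) (y j.+1 (X j.+1 w)) * time_step T N)%R]%E.

End ValueFunctions.

(* Main.v *)
Require Import Defs.
From mathcomp Require Import measurable_realfun ring lra.

Set Implicit Arguments.
Unset Strict Implicit.
Unset Printing Implicit Defensive.

(** The estimate is Bessel's inequality for the [r]-th derivative of the damped
function in the quantile variable, after [r] integrations by parts.

Everything is transported to the real line. Let [w] be the Student density, [F]
its distribution function and [D Z := Z' / w]. Then [D] is the derivative with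
respect to [u = F x]: the [n]-th derivative of [h = Y \o F^-1] at [F x] is
[D^n Y (x)] ([derive1n_quantile]), where [Y] is the damped value function, and
the integral of [|h^(r)|^2] over the unit interval is that of [(D^r Y)^2 * w]
over the line ([integral_derive1n_quantile]).

The growth of the iterates [D^n Y] is tracked through symbol classes: [Z] is a
symbol of order [s] when its [n]-th derivative is bounded by a multiple of
[(1 + x^2)^((s - n) / 2)]. Orders add up under products ([symbolM]), powers of
[1 + x^2] are symbols ([symbol_bracket]), and [D] raises the order by [mu]
([symbol_dens_deriv]). The growth hypothesis makes [y] a symbol of order [p], so
that [D^n Y] is one of order [p - q + n * mu]. The condition on [q] says exactly
that [(D^r Y)^2 * w] is integrable, and it implies that [D^n Y] vanishes at
infinity for [n < r].

Hence the boundary terms vanish in the [r] integrations by parts, and the [k]-th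
coefficient of [Y] is, up to sign, [(k * pi)^-r] times the coefficient of
[D^r Y] on the cosine of frequency [k] delayed by [r] quarter periods
([Rintegral_psi_iter]). Delaying the cosines makes all derivatives of the basis
functions of one and the same form, which avoids distinguishing the parity of
[r]. For each fixed delay these functions are orthonormal ([psi_orthonormal]),
so the sum of the squared coefficients of [D^r Y] is at most the integral of
[(D^r Y)^2 * w] ([bessel_inequality]). Since [k >= K + 1] in the tail, the
factor [(k * pi)^(-2 * r)] is at most [(pi * (K + 1))^(-2 * r)]. *)

Local Open Scope classical_set_scope.
Local Open Scope ring_scope.

(** * Integration on the real line *)

Section integration_on_the_line.
Context {R : realType}.
Notation leb := (@lebesgue_measure R).
Implicit Types (f g G : R -> R) (l m : R).

(** Dominated convergence, applied to the products with the indicators of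
the domains. *)
Lemma cvg_Rintegral_sets f (D : (set R)^nat) (A : set R) :
  (forall n, measurable (D n)) -> measurable A ->
  leb.-integrable setT (EFin \o f) ->
  (forall x, (\1_(D n) x : R) @[n --> \oo] --> (\1_A x : R)) ->
  \int[leb]_(x in D n) f x @[n --> \oo] --> \int[leb]_(x in A) f x.
Proof.
move=> mD mA intf DA.
have mf : measurable_fun setT f.
  by move: intf => /integrableP[/measurable_EFinP].
have E B : measurable B ->
    \int[leb]_(x in B) f x = \int[leb]_x (f x * \1_B x).
  move=> mB; rewrite Rintegral_mkcond; apply: eq_Rintegral => x _.
  by rewrite patchE indicE; case: (x \in B); rewrite ?mulr1 ?mulr0.
rewrite E//; under eq_fun => n do rewrite (E _ (mD n)).
have [|||||/=] := @dominated_convergence _ _ _ leb setT measurableT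
  (fun n x => (f x * \1_(D n) x)%:E) (fun x => (f x * \1_A x)%:E)
  (fun x => `|f x|%:E).
- move=> n; apply/measurable_EFinP.
  exact: (measurable_funM mf (measurable_indic (mD n))).
- by apply/measurable_EFinP; exact: (measurable_funM mf (measurable_indic mA)).
- apply: aeW => x _; apply: cvg_EFin; first by apply: nearW.
  by apply: cvgM; [exact: cvg_cst|exact: DA].
- exact: integrable_norm.
- apply: aeW => x n _ /=; rewrite lee_fin normrM ler_piMr//.
  by rewrite indicE; case: (_ \in _); rewrite ?normr1 ?normr0.
move=> iA _ h; apply: fine_cvg; rewrite fineK//.
exact: integrable_fin_num iA.
Qed.

Lemma cvg_Rintegral_Ny_y f : leb.-integrable setT (EFin \o f) ->
  \int[leb]_(x in `]-oo, t]) f x @[t --> +oo] --> \int[leb]_x f x.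
Proof.
move=> intf; apply/cvg_pinftyP => u uy.
apply: cvg_Rintegral_sets => // x.
apply: cvg_near_cst; move/cvgryPge : uy => /(_ x).
apply: filterS => n xn; rewrite !indicE !mem_set//=.
Qed.

Lemma cvg_Rintegral_Ny_Ny f : leb.-integrable setT (EFin \o f) ->
  \int[leb]_(x in `]-oo, t]) f x @[t --> -oo] --> 0.
Proof.
move=> intf; rewrite cvgNy_compNP; apply/cvg_pinftyP => u uy.
rewrite -(Rintegral_set0 leb f).
apply: cvg_Rintegral_sets => // x.
apply: cvg_near_cst; move/cvgryPgt : uy => /(_ (- x)).
apply: filterS => n xn; rewrite !indicE [in RHS]memNset// memNset//=.
by rewrite in_itv/= => xu; move: xn; rewrite ltrNl ltNge xu.
Qed.

Lemma is_derive_Rintegral_Ny f (x : R) : leb.-integrable setT (EFin \o f) ->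
  continuous f ->
  is_derive x 1 (fun t => \int[leb]_(z in `]-oo, t]) f z) (f x).
Proof.
move=> intf cf.
have [] := @continuous_FTC1 R f -oo%O x (x + 1).
- by rewrite ltrDl.
- by apply: integrableS intf.
- by rewrite ltNyr.
- exact: cf.
by move=> h1 <-; split => //; rewrite derive1E.
Qed.

(** The fundamental theorem of calculus on the whole line. The difference
[G - H], with [H t] the integral of [f] up to [t], has a null derivative, hence
is constant; its limits at the two infinities are compared. *)
Lemma Rintegral_derive f G l m : (forall x : R, is_derive x 1 G (f x)) ->
  continuous f -> leb.-integrable setT (EFin \o f) ->
  G x @[x --> +oo] --> l -> G x @[x --> -oo] --> m ->
  \int[leb]_x f x = l - m.
Proof.
move=> dG cf intf Gl Gm.
pose H t := \int[leb]_(z in `]-oo, t]) f z.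
have dGH (x : R) : is_derive x 1 (G - H) 0.
  have dH : is_derive x 1 H (f x) by exact: is_derive_Rintegral_Ny.
  by rewrite -(subrr (f x)); exact: is_deriveB.
have GH x : (G - H) x = (G - H) 0 by exact: is_derive_0_is_cst.
have h1 : (G - H) x @[x --> +oo] --> l - \int[leb]_x f x.
  by apply: cvgB => //; exact: cvg_Rintegral_Ny_y.
have h2 : (G - H) x @[x --> -oo] --> m - 0.
  by apply: cvgB => //; exact: cvg_Rintegral_Ny_Ny.
have e1 : l - \int[leb]_x f x = (G - H) 0.
  have h : (G - H) x @[x --> +oo] --> (G - H) 0.
    by apply: cvg_near_cst; exact: nearW.
  exact: (cvg_unique _ h1 h).
have e2 : m - 0 = (G - H) 0.
  have h : (G - H) x @[x --> -oo] --> (G - H) 0.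
    by apply: cvg_near_cst; exact: nearW.
  exact: (cvg_unique _ h2 h).
lra.
Qed.

Lemma gt0_derive_lt f G : (forall x : R, is_derive x 1 G (f x)) ->
  (forall x, 0 < f x) -> {homo G : x y / x < y}.
Proof.
move=> dG f0 x y xy; have [|c _ h] := @MVT R G f x y xy (fun z _ => dG z).
  apply: continuous_subspaceT => z; apply/differentiable_continuous.
  by apply/derivable1_diffP; have [] := dG z.
by rewrite -subr_gt0 h mulr_gt0 ?subr_gt0.
Qed.

(** A function with a positive derivative lies strictly between its limits. *)
Lemma gt0_derive_itv f G l m : (forall x : R, is_derive x 1 G (f x)) ->
  (forall x, 0 < f x) -> G x @[x --> +oo] --> l -> G x @[x --> -oo] --> m ->
  forall x, m < G x < l.
Proof.
move=> dG f0 Gl Gm x; have ltG := gt0_derive_lt dG f0.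
have leG : {homo G : x y / x <= y}.
  by move=> z t; rewrite le_eqVlt => /predU1P[->//|/ltG/ltW].
have G0 z : m <= G z.
  apply: (cvgr_to_le Gm).
  by near=> t; apply: leG; near: t; apply: nbhs_ninfty_le; exact: num_real.
have G1 z : G z <= l.
  apply: (cvgr_to_ge Gl).
  by near=> t; apply: leG; near: t; apply: nbhs_pinfty_ge; exact: num_real.
apply/andP; split.
  by apply: (le_lt_trans (G0 (x - 1))); apply: ltG; lra.
by apply: (lt_le_trans _ (G1 (x + 1))); apply: ltG; lra.
Unshelve. all: by end_near. Qed.

End integration_on_the_line.

Section real_integrable.
Context {R : realType}.
Notation leb := (@lebesgue_measure R).
Implicit Types (f g : R -> R).

(** Lebesgue integrability on the whole line of a real-valued function. *)
Definition rintegrable f := leb.-integrable setT (EFin \o f).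

Lemma rintegrableD f g : rintegrable f -> rintegrable g ->
  rintegrable (fun x => f x + g x).
Proof. by move=> intf intg; have := integrableD measurableT intf intg. Qed.

Lemma rintegrableZ (c : R) f : rintegrable f -> rintegrable (fun x => c * f x).
Proof. by move=> intf; have := integrableZl measurableT c intf. Qed.

Lemma le_rintegrable f g : continuous f -> rintegrable g ->
  (forall x, `|f x| <= g x) -> rintegrable f.
Proof.
move=> cf intg fg; apply: (le_integrable measurableT _ _ intg).
  by apply/measurable_EFinP; exact: continuous_measurable_fun.
move=> x _ /=; rewrite lee_fin (le_trans (fg x))//.
exact: ler_norm.
Qed.

Lemma eq_rintegrable f g : f =1 g -> rintegrable g -> rintegrable f.
Proof. by move=> /funext ->. Qed.

Lemma rintegralD f g : rintegrable f -> rintegrable g ->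
  \int[leb]_x (f x + g x) = \int[leb]_x f x + \int[leb]_x g x.
Proof. by move=> intf intg; rewrite RintegralD. Qed.

Lemma rintegralZ (c : R) f : rintegrable f ->
  \int[leb]_x (c * f x) = c * \int[leb]_x f x.
Proof. by move=> intf; rewrite RintegralZl. Qed.

Lemma eq_rintegral f g : f =1 g -> \int[leb]_x f x = \int[leb]_x g x.
Proof. by move=> fg; apply: eq_Rintegral => x _; exact: fg. Qed.

End real_integrable.

(** * Densities, quantiles and change of variables *)

Section density.
Context {R : realType}.
Notation leb := (@lebesgue_measure R).
Implicit Types (x u : R).

(** [w] is a continuous positive probability density on the line and [F] is its
cumulative distribution function. The normalization to mass one is carried by
the two limits of [F]. *)
Record is_density (F w : R -> R) : Prop := IsDensity {
  density_gt0 : forall x, 0 < w x ;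
  density_continuous : continuous w ;
  density_integrable : leb.-integrable setT (EFin \o w) ;
  cdf_derive : forall x, is_derive x 1 F (w x) ;
  cdf_cvgNy : F x @[x --> -oo] --> (0 : R) ;
  cdf_cvgy : F x @[x --> +oo] --> (1 : R) }.

Variables (F w : R -> R).
Hypothesis Fw : is_density F w.

Lemma cdf_continuous : continuous F.
Proof.
move=> x; apply/differentiable_continuous/derivable1_diffP.
by have [] := cdf_derive Fw x.
Qed.

Lemma cdf_lt : {homo F : x y / x < y}.
Proof. exact: gt0_derive_lt (cdf_derive Fw) (density_gt0 Fw). Qed.

Lemma cdf_le : {homo F : x y / x <= y}.
Proof. by move=> x y; rewrite le_eqVlt => /predU1P[->//|/cdf_lt/ltW]. Qed.

Lemma cdf_inj : injective F.
Proof. by move=> x y; case: (ltgtP x y) => // /cdf_lt; lra. Qed.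

Lemma cdf_itv x : 0 < F x < 1.
Proof.
exact: (gt0_derive_itv (cdf_derive Fw) (density_gt0 Fw) (cdf_cvgy Fw)
  (cdf_cvgNy Fw)).
Qed.

Lemma cdf_surj u : 0 < u < 1 -> exists x, F x = u.
Proof.
move=> /andP[u0 u1].
have /filter_ex[a Fa] : \forall t \near -oo, F t < u.
  exact: cvgr_lt (cdf_cvgNy Fw) _ u0.
have /filter_ex[b Fb] : \forall t \near +oo, u < F t.
  exact: cvgr_gt (cdf_cvgy Fw) _ u1.
have ab : a <= b.
  by rewrite leNgt; apply/negP => /cdf_lt; lra.
have [|c _ <-] := @IVT R F a b u ab (continuous_subspaceT cdf_continuous).
  by rewrite ge_min le_max (ltW Fa) (ltW Fb) orbT.
by exists c.
Qed.

(** The inverse of the distribution function on [`]0, 1[], null elsewhere. *)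
Definition quantile : R -> R := 'pinv_(fun=> 0) [set: R] F.

Lemma cdfK : cancel F quantile.
Proof.
by move=> x; apply: pinvKV; rewrite ?inE// => y z _ _; exact: cdf_inj.
Qed.

Lemma is_derive_quantile x : is_derive (F x) 1 quantile (w x)^-1.
Proof.
apply: is_derive_inverse.
- by near=> z; exact: cdfK.
- by near=> z; exact: cdf_continuous.
- exact: (cdf_derive Fw).
- by rewrite gt_eqF// (density_gt0 Fw).
Unshelve. all: by end_near. Qed.

(** The change of variables [u = F x]: it holds on every interval [`[-n, n]],
and both sides are limits over these intervals. *)
Lemma integral_cdf (g : R -> R) :
  {in `]0, 1[, continuous g} -> (forall u, 0 <= g u) ->
  (\int[leb]_(u in `]0%R, 1%R[) (g u)%:E = \int[leb]_x (g (F x) * w x)%:E)%E.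
Proof.
move=> cg g0.
have F'E : F^`()%classic = w.
  by apply/funext => x; rewrite derive1E; have [_ ->] := cdf_derive Fw x.
pose D (n : nat) := `[F (- n%:R), F n%:R]%classic.
pose E (n : nat) := `[- n%:R, n%:R : R]%classic.
have mw : measurable_fun setT w.
  by apply: continuous_measurable_fun; exact: (density_continuous Fw).
have cgF : continuous (fun x => g (F x) * w x).
  move=> x; apply: cvgM; last exact: (density_continuous Fw).
  apply: (@continuous_comp _ _ _ F g x); first exact: cdf_continuous.
  by apply: cg; rewrite in_itv/= cdf_itv.
have UD : \bigcup_n D n = `]0, 1[%classic.
  apply/seteqP; split => [u [n _]|u]; rewrite /D/= !in_itv/=.
    by have := cdf_itv (- n%:R); have := cdf_itv n%:R; lra.
  move=> /cdf_surj[x <-]; exists (Num.truncn `|x|).+1 => //=; rewrite in_itv/=.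
  have := truncnS_gt `|x|; rewrite ltr_norml => /andP[h1 h2].
  by rewrite !cdf_le// ltW.
have UE : \bigcup_n E n = setT.
  apply/seteqP; split => // x _; exists (Num.truncn `|x|).+1 => //=.
  rewrite /E/= in_itv/=.
  have := truncnS_gt `|x|; rewrite ltr_norml => /andP[h1 h2].
  by rewrite !ltW.
have nN (n m : nat) : (n <= m)%N -> n%:R <= m%:R :> R by rewrite ler_nat.
have hD : (\int[leb]_(u in D n) (g u)%:E @[n --> \oo] -->
          \int[leb]_(u in `]0%R, 1%R[) (g u)%:E)%E.
  rewrite -UD; apply: ge0_nondecreasing_set_cvg_integral => //.
  - move=> n m nm; apply/subsetPset => u; rewrite /D/= !in_itv/=.
    move=> /andP[h1 h2]; rewrite (le_trans _ h1) ?(le_trans h2)//;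
      apply: cdf_le.
      exact: nN.
    by rewrite lerN2 nN.
  - by move=> n; exact: measurable_itv.
  - move=> n; apply/measurable_EFinP.
    have mg : measurable_fun `]0 : R, 1 : R[%classic g.
      apply: open_continuous_measurable_fun => // u; rewrite inE => hu.
      exact: cg.
    have DS : D n `<=` `]0, 1[%classic.
      move=> u; rewrite /D /= !in_itv/=.
      by have := cdf_itv (- n%:R); have := cdf_itv n%:R; lra.
    exact: (measurable_funS (measurable_itv _) DS mg).
  - by move=> n u _; rewrite lee_fin.
have hE : (\int[leb]_(x in E n) (g (F x) * w x)%:E @[n --> \oo] -->
          \int[leb]_x (g (F x) * w x)%:E)%E.
  rewrite -UE; apply: ge0_nondecreasing_set_cvg_integral => //.
  - move=> n m nm; apply/subsetPset => u; rewrite /E/= !in_itv/=.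
    move=> /andP[h1 h2]; rewrite (le_trans _ h1) ?(le_trans h2)//.
      exact: nN.
    by rewrite lerN2 nN.
  - by move=> n; exact: measurable_itv.
  - move=> n; apply/measurable_EFinP; apply: measurable_funTS.
    exact: continuous_measurable_fun.
  - by move=> n u _; rewrite lee_fin mulr_ge0// ltW// (density_gt0 Fw).
suff DE n : (\int[leb]_(x in E n) (g (F x) * w x)%:E =
             \int[leb]_(u in D n) (g u)%:E)%E.
  suff hD' : (\int[leb]_(u in D n) (g u)%:E @[n --> \oo] -->
      \int[leb]_x (g (F x) * w x)%:E)%E by exact: (cvg_unique _ hD hD').
  by apply: cvg_trans hE; apply: near_eq_cvg; apply: nearW => n; exact: DE.
rewrite /D /E; symmetry.
rewrite integration_by_substitution_increasing ?F'E//.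
- by rewrite (le_trans _ (ler0n R n))// oppr_le0 ler0n.
- by move=> x y _ _; exact: cdf_lt.
- by move=> x _; exact: (density_continuous Fw).
- by apply/cvg_ex; exists (w (- n%:R)); apply: cvg_at_right_filter;
    exact: (density_continuous Fw).
- by apply/cvg_ex; exists (w n%:R); apply: cvg_at_left_filter;
    exact: (density_continuous Fw).
- split.
  + by move=> x _; have [] := cdf_derive Fw x.
  + by apply: cvg_at_right_filter; exact: cdf_continuous.
  + by apply: cvg_at_left_filter; exact: cdf_continuous.
- apply: continuous_in_subspaceT => u; rewrite inE/= in_itv/= => hu.
  apply: cg; rewrite in_itv/=.
  by have := cdf_itv (- n%:R); have := cdf_itv n%:R; lra.
Qed.

End density.

(** * Differentiation with respect to a distribution function *)

Section density_derivative.
Context {R : realType}.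
Implicit Types (Z : R -> R).

(** The derivative of [Z] with respect to the distribution function of density
[w], so that [D Z (x)] is the derivative of [Z \o quantile F] at [F x]. *)
Definition dens_deriv (w Z : R -> R) (x : R) : R := Z^`()%classic x / w x.

Variables (F w : R -> R).
Hypothesis Fw : is_density F w.
Notation leb := (@lebesgue_measure R).
Notation D := (dens_deriv w).

Lemma near_itv01 (x : R) : \forall v \near F x, 0 < v < 1.
Proof.
have := cdf_itv Fw x => /andP[h0 h1]; near=> v; apply/andP; split.
  by near: v; exact: lt_nbhsr.
by near: v; exact: lt_nbhsl.
Unshelve. all: by end_near. Qed.

(** On the range [`]0, 1[] of [F], the iterated derivatives of [Y \o quantile F]
are the iterates of [dens_deriv w] read through [F]. *)
Lemma derive1n_quantile (Y : R -> R) n :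
  (forall m x, (m < n)%N -> derivable (iter m D Y) x 1) ->
  forall x, (Y \o quantile F)^`(n)%classic (F x) = iter n D Y x.
Proof.
elim: n => [_ x|n IH dY x]; first by rewrite derive1n0 /= (cdfK Fw).
have {}IH := IH (fun m x mn => dY m x (ltnW mn)).
have E : {near F x,
    (Y \o quantile F)^`(n)%classic =1 (iter n D Y) \o quantile F}.
  near=> v; have : 0 < v < 1 by near: v; exact: near_itv01.
  by move=> /(cdf_surj Fw)[z <-]; rewrite IH /= (cdfK Fw).
rewrite derive1nS derive1E (near_eq_derive _ E).
have dq := is_derive_quantile Fw x.
have dn : is_derive (quantile F (F x)) 1 (iter n D Y)
    ((iter n D Y)^`()%classic x).
  rewrite (cdfK Fw) derive1E; apply: DeriveDef => //.
  exact: dY.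
by have [_ ->] := is_derive1_comp dn dq.
Unshelve. all: by end_near. Qed.

Lemma integral_derive1n_quantile (Y : R -> R) r :
  (forall m x, (m < r)%N -> derivable (iter m D Y) x 1) ->
  continuous (iter r D Y) ->
  (\int[leb]_(u in `]0%R, 1%R[)
     (`|(Y \o quantile F)^`(r)%classic u| ^+ 2)%:E =
   \int[leb]_x ((iter r D Y x) ^+ 2 * w x)%:E)%E.
Proof.
move=> dY cY; rewrite (integral_cdf Fw) //.
- apply: eq_integral => x _; congr EFin.
  by rewrite derive1n_quantile// real_normK// num_real.
- move=> u; rewrite in_itv/= => /(cdf_surj Fw)[x <-].
  have cq : {for F x, continuous (quantile F)}.
    apply/differentiable_continuous/derivable1_diffP.
    by have [] := is_derive_quantile Fw x.
  have cq2 : {for F x,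
      continuous (fun v => `|(iter r D Y \o quantile F) v| ^+ 2)}.
    apply: (@continuous_comp _ _ _ _ (fun z : R => z ^+ 2)).
      by apply: cvg_norm; apply: continuous_comp => //; exact: cY.
    exact: exprn_continuous.
  rewrite /continuous_at derive1n_quantile//.
  have cq3 : `|iter r D Y (quantile F v)| ^+ 2 @[v --> F x] -->
      `|iter r D Y (quantile F (F x))| ^+ 2 := cq2.
  move: cq3; rewrite (cdfK Fw); apply: cvg_trans.
  apply: near_eq_cvg.
  near=> v; have : 0 < v < 1 by near: v; exact: near_itv01.
  by move=> /(cdf_surj Fw)[z <-]; rewrite derive1n_quantile// (cdfK Fw).
Unshelve. all: by end_near. Qed.

End density_derivative.

(** * The cosine system of a density *)

Section cosine_system.
Context {R : realType}.
Variables (F w : R -> R).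
Hypothesis Fw : is_density F w.
Notation leb := (@lebesgue_measure R).
Notation D := (dens_deriv w).
Implicit Types (G Z : R -> R) (m k : nat).

(** The cosine of frequency [k] composed with [F], delayed by [m] quarter
periods: [psi 0 k] is the [k]-th basis function for [0 < k], and [psi m k] is,
up to the factor [k * pi * w], the derivative of [psi m.+1 k]. *)
Definition psi m k (x : R) : R :=
  Num.sqrt 2 * cos (k%:R * pi * F x - m%:R * (pi / 2)).

Lemma psi_le m k x : `|psi m k x| <= Num.sqrt 2.
Proof.
by rewrite normrM ger0_norm ?sqrtr_ge0// ler_piMr ?sqrtr_ge0// cos_max.
Qed.

Lemma is_derive_psi m k (x : R) :
  is_derive x 1 (psi m.+1 k) (k%:R * pi * (psi m k x * w x)).
Proof.
have dF := cdf_derive Fw x.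
rewrite /psi; apply: is_derive_eq.
rewrite /GRing.scale/= subr0.
have -> : k%:R * pi * F x - m.+1%:R * (pi / 2) =
    (k%:R * pi * F x - m%:R * (pi / 2)) - pi / 2 by rewrite -natr1; ring.
by rewrite sinBpihalf; ring.
Qed.

Lemma continuous_cos_cdf (a b : R) : continuous (fun x => cos (a * F x + b)).
Proof.
move=> x; apply: (@continuous_comp _ _ _ (fun x => a * F x + b) cos).
  apply: cvgD; last exact: cvg_cst.
  by apply: cvgM; [exact: cvg_cst|exact: (cdf_continuous Fw)].
exact: continuous_cos.
Qed.

Lemma psi_continuous m k : continuous (psi m k).
Proof.
move=> x; apply: cvgM; first exact: cvg_cst.
exact: continuous_cos_cdf.
Qed.

Lemma rintegrable_density : rintegrable w.
Proof. exact: density_integrable Fw. Qed.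

Lemma Rintegral_density : \int[leb]_x w x = 1.
Proof.
rewrite (Rintegral_derive (cdf_derive Fw) (density_continuous Fw)
  rintegrable_density (cdf_cvgy Fw) (cdf_cvgNy Fw)).
by rewrite subr0.
Qed.

Lemma rintegrable_bounded G (M : R) : continuous G -> (forall x, `|G x| <= M) ->
  rintegrable (fun x => G x * w x).
Proof.
move=> cG GM; apply: (le_rintegrable _ (rintegrableZ M rintegrable_density)).
  by move=> x; apply: cvgM; [exact: cG|exact: (density_continuous Fw)].
move=> x; have w0 := density_gt0 Fw x.
by rewrite normrM (gtr0_norm w0) ler_wpM2r// ltW.
Qed.

Lemma sin_natpi n : sin (n%:R * pi) = 0 :> R.
Proof.
elim: n => [|n IH]; first by rewrite mul0r sin0.
by rewrite -natr1 mulrDl mul1r sinDpi IH oppr0.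
Qed.

Lemma Rintegral_cos_cdf (a b : R) :
  a != 0 -> sin (a * pi + b) = 0 -> sin b = 0 ->
  \int[leb]_x (cos (a * pi * F x + b) * w x) = 0.
Proof.
move=> a0 s1 s0; have pi0 : (pi : R) != 0 by rewrite gt_eqF// pi_gt0.
have lim (H : set_system R) (FH : Filter H) (c : R) : F x @[x --> H] --> c ->
    (a * pi)^-1 * sin (a * pi * F x + b) @[x --> H] -->
    (a * pi)^-1 * sin (a * pi * c + b).
  move=> Fc; apply: cvgM; first exact: cvg_cst.
  apply: (@cvg_comp _ _ _ (fun x => a * pi * F x + b) sin);
    last exact: continuous_sin.
  by apply: cvgD; [apply: cvgM; [exact: cvg_cst|exact: Fc]|exact: cvg_cst].
have d (x : R) : is_derive x 1 (fun x => (a * pi)^-1 * sin (a * pi * F x + b))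
    (cos (a * pi * F x + b) * w x).
  have dF := cdf_derive Fw x.
  apply: is_derive_eq; rewrite /GRing.scale/=.
  by rewrite addr0 mulrCA [_^-1 * _]mulrA mulVf ?mul1r// mulf_neq0.
rewrite (Rintegral_derive d _ _ (lim _ _ _ (cdf_cvgy Fw))
  (lim _ _ _ (cdf_cvgNy Fw))).
- by rewrite mulr1 mulr0 add0r s1 s0 mulr0 subr0.
- move=> x; apply: cvgM; last exact: (density_continuous Fw).
  exact: continuous_cos_cdf.
- apply: (@rintegrable_bounded (fun x => cos (a * pi * F x + b)) 1) => [|x].
    exact: continuous_cos_cdf.
  exact: cos_max.
Qed.

(** For each delay [m] the [psi m k], [0 < k], are orthonormal: a product of two
of them is a sum of two cosines, whose integrals are computed by
[Rintegral_cos_cdf]. *)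
Lemma psi_orthonormal m j k : (0 < j)%N -> (0 < k)%N ->
  \int[leb]_x (psi m j x * psi m k x * w x) = (j == k)%:R.
Proof.
move=> j0 k0.
pose c1 x := cos ((j%:R - k%:R) * pi * F x + 0).
pose c2 x := cos ((j + k)%:R * pi * F x + - (m%:R * pi)).
have i1 : rintegrable (fun x => c1 x * w x).
  by apply: (@rintegrable_bounded c1 1) => [|x];
    [exact: continuous_cos_cdf|exact: cos_max].
have i2 : rintegrable (fun x => c2 x * w x).
  by apply: (@rintegrable_bounded c2 1) => [|x];
    [exact: continuous_cos_cdf|exact: cos_max].
have E x : psi m j x * psi m k x * w x = c1 x * w x + c2 x * w x.
  rewrite -mulrDl; congr (_ * _); rewrite /psi /c1 /c2.
  set A := j%:R * pi * F x - _; set B := k%:R * pi * F x - _.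
  have -> : (j%:R - k%:R) * pi * F x + 0 = A - B by rewrite /A /B; ring.
  have -> : (j + k)%:R * pi * F x + - (m%:R * pi) = A + B.
    by rewrite /A /B natrD; field.
  rewrite (cosB A B) (cosD A B) mulrACA -expr2 sqr_sqrtr//.
  by ring.
rewrite (eq_rintegral E) rintegralD//.
rewrite [X in _ + X]Rintegral_cos_cdf ?addr0.
- have [jk|jk] := eqVneq j k.
    rewrite -[RHS]Rintegral_density; apply: eq_rintegral => x.
    by rewrite /c1 jk subrr !mul0r addr0 cos0 mul1r.
  rewrite Rintegral_cos_cdf// ?addr0 ?sin0//.
    by rewrite subr_eq0 eqr_nat.
  by rewrite mulrBl sinB !sin_natpi mul0r mulr0 subrr.
- by rewrite pnatr_eq0 addn_eq0 negb_and -!lt0n j0.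
- by rewrite sinB !sin_natpi mul0r mulr0 subrr.
- by rewrite sinN sin_natpi oppr0.
Qed.

(** From [`|G| <= G ^+ 2 + 1] and the boundedness of [psi]. *)
Lemma rintegrable_sqr_psi G m k : continuous G ->
  rintegrable (fun x => G x ^+ 2 * w x) ->
  rintegrable (fun x => G x * psi m k x * w x).
Proof.
move=> cG iG; apply: (@le_rintegrable _ _
    (fun x => Num.sqrt 2 * (G x ^+ 2 * w x + w x))).
- move=> x; apply: cvgM; last exact: (density_continuous Fw).
  by apply: cvgM; [exact: cG|exact: psi_continuous].
- by apply: rintegrableZ; apply: rintegrableD => //; exact: rintegrable_density.
- move=> x; have w0 := density_gt0 Fw x.
  rewrite normrM [`|G x * _|]normrM (gtr0_norm w0).
  have -> : Num.sqrt 2 * (G x ^+ 2 * w x + w x) =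
      (G x ^+ 2 + 1) * Num.sqrt 2 * w x by ring.
  rewrite ler_wpM2r ?(ltW w0)// ler_pM ?psi_le//.
  rewrite -[G x ^+ 2]real_normK ?num_real//.
  by have := sqr_ge0 (`|G x| - 1); have := sqr_ge0 (`|G x|); lra.
Qed.

(** By induction on [n], for all [G] at once: subtracting from [G] its component
along [psi m n] leaves the other coefficients unchanged and removes the square
of that component from the integral of [G ^+ 2 * w]. *)
Lemma bessel_inequality m K n G : continuous G ->
  rintegrable (fun x => G x ^+ 2 * w x) ->
  \sum_(K.+1 <= k < n) (\int[leb]_x (G x * psi m k x * w x)) ^+ 2 <=
  \int[leb]_x (G x ^+ 2 * w x).
Proof.
elim: n G => [|n IH] G cG iG.
  rewrite big_geq//; apply: Rintegral_ge0 => x _.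
  by rewrite mulr_ge0 ?sqr_ge0// ltW// (density_gt0 Fw).
have [Kn|nK] := ltnP K n; last first.
  rewrite big_geq//; apply: Rintegral_ge0 => x _.
  by rewrite mulr_ge0 ?sqr_ge0// ltW// (density_gt0 Fw).
have n0 : (0 < n)%N by exact: leq_ltn_trans Kn.
rewrite big_nat_recr//=.
set b := \int[leb]_x (G x * psi m n x * w x).
pose H x := G x - b * psi m n x.
have cpsi := @psi_continuous m n.
have cH : continuous H.
  move=> x; apply: cvgB; first exact: cG.
  by apply: cvgM; [exact: cvg_cst|exact: cpsi].
have ipp k : rintegrable (fun x => psi m n x * psi m k x * w x).
  apply: (@rintegrable_bounded _ (Num.sqrt 2 * Num.sqrt 2)).
    by move=> x; apply: cvgM; exact: psi_continuous.
  by move=> x; rewrite normrM ler_pM// psi_le.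
have iGp k : rintegrable (fun x => G x * psi m k x * w x).
  exact: rintegrable_sqr_psi.
have EH x : H x ^+ 2 * w x = G x ^+ 2 * w x +
    ((- (2 * b)) * (G x * psi m n x * w x) +
     b ^+ 2 * (psi m n x * psi m n x * w x)).
  by rewrite /H; ring.
have iH : rintegrable (fun x => H x ^+ 2 * w x).
  apply: (eq_rintegrable EH); apply: rintegrableD => //.
  by apply: rintegrableD; exact: rintegrableZ.
have IntH : \int[leb]_x (H x ^+ 2 * w x) =
    \int[leb]_x (G x ^+ 2 * w x) - b ^+ 2.
  rewrite (eq_rintegral EH) rintegralD//; last first.
    by apply: rintegrableD; exact: rintegrableZ.
  rewrite rintegralD; [|exact: rintegrableZ..].
  rewrite !rintegralZ// psi_orthonormal// eqxx -/b mulr1.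
  by ring.
have := IH H cH iH; rewrite IntH lerBrDr; apply: le_trans.
rewrite lerD2r big_nat [leRHS]big_nat; apply: ler_sum => k /andP[Kk kn].
have EHk x : H x * psi m k x * w x =
    G x * psi m k x * w x + (- b) * (psi m n x * psi m k x * w x).
  by rewrite /H; ring.
rewrite (eq_rintegral EHk) rintegralD//; last exact: rintegrableZ.
rewrite rintegralZ// psi_orthonormal ?(leq_ltn_trans _ Kk)//.
by rewrite gtn_eqF// mulr0 addr0.
Qed.

(** Integration of the derivative of [Z * psi m.+1 k], which vanishes at both
infinities. *)
Lemma Rintegral_psi_by_parts Z m k : (0 < k)%N ->
  (forall x, derivable Z x 1) -> continuous (D Z) ->
  rintegrable (fun x => Z x ^+ 2 * w x) ->
  rintegrable (fun x => D Z x ^+ 2 * w x) ->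
  Z x @[x --> -oo] --> 0 -> Z x @[x --> +oo] --> 0 ->
  \int[leb]_x (Z x * psi m k x * w x) =
  - (k%:R * pi)^-1 * \int[leb]_x (D Z x * psi m.+1 k x * w x).
Proof.
move=> k0 dZ cDZ iZ iDZ ZNy Zy.
have cZ : continuous Z.
  by move=> x; apply/differentiable_continuous/derivable1_diffP; exact: dZ.
have kp0 : k%:R * pi != 0 :> R.
  by rewrite mulf_neq0// ?gt_eqF ?pi_gt0// ltr0n.
have lim (H : set_system R) (FH : Filter H) : Z x @[x --> H] --> 0 ->
    Z x * psi m.+1 k x @[x --> H] --> 0.
  move=> Z0; apply: norm_cvg0.
  apply: (@squeeze_cvgr _ _ _ _ (fun=> 0) (fun x => `|Z x| * Num.sqrt 2)).
  - by apply: nearW => x; rewrite normr_ge0/= normrM ler_wpM2l// psi_le.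
  - exact: cvg_cst.
  - rewrite -(mul0r (Num.sqrt 2)) -(normr0 R).
    by apply: cvgM; [exact: cvg_norm|exact: cvg_cst].
have i1 : rintegrable (fun x => D Z x * psi m.+1 k x * w x).
  exact: rintegrable_sqr_psi.
have i2 : rintegrable (fun x => k%:R * pi * (Z x * psi m k x * w x)).
  by apply: rintegrableZ; exact: rintegrable_sqr_psi.
have d (x : R) : is_derive x 1 (fun x => Z x * psi m.+1 k x)
    (D Z x * psi m.+1 k x * w x + k%:R * pi * (Z x * psi m k x * w x)).
  have dp := is_derive_psi m k x.
  have dZx : is_derive x 1 Z (Z^`()%classic x).
    by rewrite derive1E; exact: DeriveDef.
  apply: is_derive_eq; rewrite /GRing.scale/= /dens_deriv.
  by field; rewrite gt_eqF// (density_gt0 Fw).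
have cd : continuous
    (fun x => D Z x * psi m.+1 k x * w x + k%:R * pi * (Z x * psi m k x * w x)).
  have cw := density_continuous Fw; have cp n := @psi_continuous n k.
  move=> x; apply: cvgD.
    by apply: cvgM; [apply: cvgM; [exact: cDZ|exact: cp]|exact: cw].
  apply: cvgM; first exact: cvg_cst.
  by apply: cvgM; [apply: cvgM; [exact: cZ|exact: cp]|exact: cw].
have := Rintegral_derive d cd (rintegrableD i1 i2) (lim _ _ Zy) (lim _ _ ZNy).
rewrite subr0 rintegralD// rintegralZ; last exact: rintegrable_sqr_psi.
move=> h; apply: (mulfI kp0); rewrite mulrA mulrN divff// mulN1r.
apply/eqP; rewrite -addr_eq0 addrC; apply/eqP.
exact: (h _ _).
Qed.

Lemma Rintegral_psi_iter (Y : R -> R) r k : (0 < k)%N ->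
  (forall n x, (n < r)%N -> derivable (iter n D Y) x 1) ->
  (forall n, (n <= r)%N -> continuous (iter n D Y)) ->
  (forall n, (n <= r)%N -> rintegrable (fun x => iter n D Y x ^+ 2 * w x)) ->
  (forall n, (n < r)%N -> iter n D Y x @[x --> -oo] --> 0) ->
  (forall n, (n < r)%N -> iter n D Y x @[x --> +oo] --> 0) ->
  \int[leb]_x (Y x * psi 0 k x * w x) =
  (- (k%:R * pi)^-1) ^+ r * \int[leb]_x (iter r D Y x * psi r k x * w x).
Proof.
move=> k0 dY cY iY YNy Yy.
suff H n : (n <= r)%N -> \int[leb]_x (Y x * psi 0 k x * w x) =
    (- (k%:R * pi)^-1) ^+ n * \int[leb]_x (iter n D Y x * psi n k x * w x).
  exact: H.
elim: n => [_|n IH nr]; first by rewrite expr0 mul1r.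
rewrite IH ?(ltnW nr)// exprSr -mulrA; congr (_ * _).
apply: Rintegral_psi_by_parts => //.
- by move=> x; exact: dY.
- exact: (cY n.+1).
- by apply: iY; exact: ltnW.
- exact: (iY n.+1).
- exact: YNy.
- exact: Yy.
Qed.

End cosine_system.

(** * Powers of the Japanese bracket *)

Section bracket.
Context {R : realType}.
Notation leb := (@lebesgue_measure R).
Implicit Types (a b s x : R).

(** The power [a] of the Japanese bracket, [(1 + x ^+ 2) `^ (a / 2)]. *)
Definition bracket a x : R := (1 + x ^+ 2) `^ (a / 2).

Lemma sqrD1_gt0 x : 0 < 1 + x ^+ 2.
Proof. by rewrite ltr_pwDl// sqr_ge0. Qed.

Lemma bracket_gt0 a x : 0 < bracket a x.
Proof. exact/powR_gt0/sqrD1_gt0. Qed.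

Lemma bracketD a b x : bracket (a + b) x = bracket a x * bracket b x.
Proof. by rewrite /bracket mulrDl powRD// (gt_eqF (sqrD1_gt0 x)) implybT. Qed.

Lemma bracketN a x : bracket (- a) x = (bracket a x)^-1.
Proof. by rewrite /bracket mulNr powRN. Qed.

Lemma bracket0 x : bracket 0 x = 1.
Proof. by rewrite /bracket mul0r powRr0. Qed.

Lemma bracket1 x : bracket 1 x = Num.sqrt (1 + x ^+ 2).
Proof. by rewrite /bracket mul1r powR12_sqrt// ltW// sqrD1_gt0. Qed.

Lemma ler_norm_bracket x : `|x| <= bracket 1 x.
Proof. by rewrite bracket1 -sqrtr_sqr ler_wsqrtr// lerDr. Qed.

Lemma bracketX (n : nat) x : bracket n%:R x = bracket 1 x ^+ n.
Proof.
elim: n => [|n IH]; first by rewrite bracket0 expr0.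
by rewrite -natr1 bracketD IH exprSr.
Qed.

Lemma is_derive_bracket a x :
  is_derive x 1 (bracket a) (a * (x * bracket (a - 2) x)).
Proof.
have x0 := sqrD1_gt0 x.
have d1 : is_derive x 1 (fun x : R => 1 + x ^+ 2) (2 * x).
  by apply: is_derive_eq; rewrite /GRing.scale/=; ring.
have d2 : is_derive (1 + x ^+ 2) 1 (fun z : R => z `^ (a / 2)) _ :=
  is_derive1_powR (a / 2) x0.
have := @is_derive1_comp R (fun z => z `^ (a / 2)) (fun x => 1 + x ^+ 2)
  x _ _ d2 d1.
have -> : a / 2 * (1 + x ^+ 2) `^ (a / 2 - 1) * (2 * x) =
          a * (x * bracket (a - 2) x).
  rewrite /bracket (_ : (a - 2) / 2 = a / 2 - 1); by field.
by [].
Qed.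

Lemma bracket_continuous a : continuous (bracket a).
Proof.
move=> x; apply/differentiable_continuous/derivable1_diffP.
by have [] := is_derive_bracket a x.
Qed.

Lemma cvg_powR_lt0 {T : Type} (H : set_system T) {FH : Filter H}
    (f : T -> R) s :
  s < 0 -> f x @[x --> H] --> +oo -> f x `^ s @[x --> H] --> 0.
Proof.
move=> s0 fy; apply/cvgr0Pnorm_lt => e e0.
have [s0' e0'] : s != 0 /\ 0 <= e^-1 by rewrite lt_eqF// invr_ge0 ltW.
near=> x.
(* the threshold is [e `^ s^-1], whose power [s] is [e] *)
have fA : (e^-1) `^ (- s)^-1 < f x.
  by near: x; move/cvgryPgt : fy; exact.
have A0 : 0 <= (e^-1) `^ (- s)^-1 by exact: powR_ge0.
have f0 := le_lt_trans A0 fA.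
rewrite ger0_norm ?powR_ge0// -[s]opprK powRN.
rewrite -[e]invrK ltf_pV2 ?posrE ?powR_gt0 ?invr_gt0//.
have -> : e^-1 = (e^-1 `^ (- s)^-1) `^ (- s).
  by rewrite -powRrM mulVf ?oppr_eq0// powRr1.
by apply: gt0_ltr_powR; rewrite ?oppr_gt0 ?nnegrE ?(ltW f0).
Unshelve. all: by end_near. Qed.

Lemma cvg_bracketNy s : s < 0 -> bracket s x @[x --> -oo] --> 0.
Proof.
move=> s0; apply: cvg_powR_lt0; first lra.
apply/cvgryPgt => A; near=> x.
have h1 : x <= - 1 by near: x; apply: nbhs_ninfty_le; exact: num_real.
have h2 : x <= - A by near: x; apply: nbhs_ninfty_le; exact: num_real.
nra.
Unshelve. all: by end_near. Qed.

Lemma cvg_brackety s : s < 0 -> bracket s x @[x --> +oo] --> 0.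
Proof.
move=> s0; apply: cvg_powR_lt0; first lra.
apply/cvgryPgt => A; near=> x.
have h1 : 1 <= x by near: x; apply: nbhs_pinfty_ge; exact: num_real.
have h2 : A <= x by near: x; apply: nbhs_pinfty_ge; exact: num_real.
nra.
Unshelve. all: by end_near. Qed.

(** On the half-line, [1 + x ^+ 2 >= (1 + x) ^+ 2 / 2] bounds [bracket s] by a
multiple of [(1 + x) `^ s], which has an explicit primitive. *)
Lemma rintegrable_bracket s : s < -1 -> rintegrable (bracket s).
Proof.
move=> s1; have s10 : s + 1 != 0 by rewrite lt_eqF//; lra.
have cb := @bracket_continuous s.
have b0 x : 0 <= bracket s x by rewrite ltW// bracket_gt0.
pose g x := (2^-1) `^ (s / 2) * (1 + x) `^ s.
pose G x := (2^-1) `^ (s / 2) / (s + 1) * (1 + x) `^ (s + 1).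
have bg x : 0 <= x -> bracket s x <= g x.
  move=> x0; rewrite /bracket /g.
  have x10 : 0 <= 1 + x by lra.
  have -> : (1 + x) `^ s = ((1 + x) ^+ 2) `^ (s / 2).
    rewrite -powR_mulrn// -powRrM; congr powR; by field.
  rewrite -powRM ?invr_ge0// ?sqr_ge0//.
  rewrite -[s / 2]opprK !(powRN _ (- (s / 2))).
  have h : 0 < 2^-1 * (1 + x) ^+ 2 by rewrite mulr_gt0// exprn_gt0//; lra.
  rewrite lef_pV2 ?posrE ?powR_gt0// ?sqrD1_gt0//.
  apply: ge0_ler_powR; rewrite ?nnegrE ?(ltW h) ?(ltW (sqrD1_gt0 x))//.
    by lra.
  have := sqr_ge0 (1 - x); nra.
have dG x : 0 <= x -> is_derive x 1 G (g x).
  move=> x0; have x10 : 0 < 1 + x by lra.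
  have d1 : is_derive x 1 (cst (1 : R) + id : R -> R) 1.
    by apply: is_derive_eq; rewrite add0r.
  have d2 : is_derive (1 + x) 1 (fun z : R => z `^ (s + 1)) _ :=
    is_derive1_powR (s + 1) x10.
  have d3 := @is_derive1_comp R (fun z => z `^ (s + 1)) (fun x => 1 + x)
    x _ _ d2 d1.
  have d4 := is_deriveZ ((2^-1) `^ (s / 2) / (s + 1)) d3.
  apply: (is_derive_eq d4).
  rewrite /GRing.scale/= /g mulr1 addrK mulrA; congr (_ * _).
  by rewrite -mulrA mulVf// mulr1.
have cg x : -1 < x -> {for x, continuous g}.
  move=> x1; have x10 : 0 < 1 + x by lra.
  apply: cvgM; first exact: cvg_cst.
  apply: (@continuous_comp _ _ _ (fun x => 1 + x) (fun z : R => z `^ s)).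
    by apply: cvgD; [exact: cvg_cst|exact: cvg_id].
  apply/differentiable_continuous/derivable1_diffP.
  by have [] := is_derive1_powR s x10.
have Gy : G x @[x --> +oo] --> 0.
  rewrite -(mulr0 ((2^-1) `^ (s / 2) / (s + 1))).
  apply: cvgM; first exact: cvg_cst.
  apply: cvg_powR_lt0; first lra.
  apply/cvgryPgt => A; near=> x.
  have : A <= x by near: x; apply: nbhs_pinfty_ge; exact: num_real.
  lra.
have cG x : 0 <= x -> {for x, continuous G}.
  move=> x0; apply/differentiable_continuous/derivable1_diffP.
  by have [] := dG _ x0.
have g0 x : 0 <= g x by rewrite mulr_ge0 ?powR_ge0.
have Ig : (\int[leb]_(x in `[0%R, +oo[) (g x)%:E = 0%:E - (G 0)%:E)%E.
  apply: ge0_continuous_FTC2y => //.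
  - apply/continuous_within_itvcyP; split.
      by move=> x; rewrite in_itv/= andbT => x0; apply: cg; lra.
    by apply: cvg_at_right_filter; apply: cg; lra.
  - by move=> x /ltW x0; have [] := dG x x0.
  - by apply: cvg_at_right_filter; exact: cG.
  - move=> x; rewrite in_itv/= andbT => /ltW x0.
    by rewrite derive1E; have [_ ->] := dG x x0.
apply/integrableP; split.
  by apply/measurable_EFinP; exact: continuous_measurable_fun.
under eq_integral do rewrite /= ger0_norm//.
rewrite ge0_symfun_integralT//; last first.
  by move=> x; rewrite /bracket /= sqrrN.
rewrite -set_itvcy lte_mul_pinfty//.
apply: (@le_lt_trans _ _ (\int[leb]_(x in `[0%R, +oo[) (g x)%:E)%E); last first.
  by rewrite Ig -EFinB ltry.
apply: ge0_le_integral => //=.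
- by move=> x _; rewrite lee_fin.
- apply/measurable_EFinP; apply: measurable_funTS.
  exact: continuous_measurable_fun.
- apply/measurable_EFinP.
  (* [g] is continuous on an open half-line containing the closed one *)
  have mg : measurable_fun `](-1 : R), +oo[ g.
    apply: open_continuous_measurable_fun => // x.
    by rewrite inE/= in_itv/= andbT; exact: cg.
  have S : `[(0 : R), +oo[ `<=` `](-1 : R), +oo[.
    by move=> x/=; rewrite !in_itv/= !andbT; lra.
  exact: (measurable_funS (measurable_itv _) S mg).
- by move=> x; rewrite /= in_itv/= andbT lee_fin; exact: bg.
Unshelve. all: by end_near. Qed.

End bracket.

(** * Symbol classes *)

Section symbol.
Context {R : realType}.
Implicit Types (Z V : R -> R) (s t a : R) (m n : nat).

(** [Z] is at most of order [s] at infinity, uniformly on the line. *)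
Definition bracket_bounded s Z := exists C, forall x, `|Z x| <= C * bracket s x.

(** The symbols of order [s] with [m] controlled derivatives: [Z] is [m] times
continuously differentiable and its [n]-th derivative is at most of order
[s - n], for [n <= m]. *)
Fixpoint symbol m s Z : Prop :=
  bracket_bounded s Z /\
  if m is m'.+1 then
    (forall x, derivable Z x 1) /\ symbol m' (s - 1) Z^`()%classic
  else continuous Z.

Lemma symbol_bounded m s Z : symbol m s Z -> bracket_bounded s Z.
Proof. by case: m => [|m] []. Qed.

Lemma derivable_continuous Z : (forall x, derivable Z x 1) -> continuous Z.
Proof.
by move=> dZ x; apply/differentiable_continuous/derivable1_diffP; exact: dZ.
Qed.

Lemma symbol_continuous m s Z : symbol m s Z -> continuous Z.
Proof.
by case: m => [[_]//|m [_ [dZ _]]]; exact: derivable_continuous.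
Qed.

Lemma symbolW m s Z : symbol m.+1 s Z -> symbol m s Z.
Proof.
elim: m s Z => [|m IH] s Z [ZC [dZ sZ]]; split => //.
  exact: derivable_continuous.
by split => //; exact: IH.
Qed.

Lemma bracket_boundedD s Z V : bracket_bounded s Z -> bracket_bounded s V ->
  bracket_bounded s (fun x => Z x + V x).
Proof.
move=> [C ZC] [B VB]; exists (C + B) => x.
by rewrite mulrDl (le_trans (ler_normD _ _))// lerD.
Qed.

Lemma bracket_boundedM s t Z V : bracket_bounded s Z -> bracket_bounded t V ->
  bracket_bounded (s + t) (fun x => Z x * V x).
Proof.
move=> [C ZC] [B VB]; exists (C * B) => x.
by rewrite normrM bracketD mulrACA ler_pM.
Qed.

Lemma derive1D_fun Z V : (forall x, derivable Z x 1) ->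
  (forall x, derivable V x 1) ->
  (fun x => Z x + V x)^`()%classic =
  (fun x => Z^`()%classic x + V^`()%classic x).
Proof. by move=> dZ dV; apply/funext => x; rewrite !derive1E deriveD. Qed.

Lemma derive1M_fun Z V : (forall x, derivable Z x 1) ->
  (forall x, derivable V x 1) ->
  (fun x => Z x * V x)^`()%classic =
  (fun x => Z^`()%classic x * V x + Z x * V^`()%classic x).
Proof.
move=> dZ dV; apply/funext => x; rewrite !derive1E deriveM// /GRing.scale/=.
by ring.
Qed.

Lemma derive1_cst_fun (c : R) :
  (fun=> c : R)^`()%classic = (fun=> 0) :> (R -> R).
Proof. by apply/funext => x; rewrite derive1_cst. Qed.

Lemma symbolD m s Z V : symbol m s Z -> symbol m s V ->
  symbol m s (fun x => Z x + V x).
Proof.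
elim: m s Z V => [|m IH] s Z V [ZC hZ] [VC hV]; split;
  [exact: bracket_boundedD| |exact: bracket_boundedD|].
  by move=> x; apply: cvgD; [exact: hZ|exact: hV].
case: hZ hV => dZ sZ [dV sV]; split; first by move=> x; exact: derivableD.
by rewrite derive1D_fun//; exact: IH.
Qed.

Lemma symbolM m s t Z V : symbol m s Z -> symbol m t V ->
  symbol m (s + t) (fun x => Z x * V x).
Proof.
elim: m s t Z V => [|m IH] s t Z V hZ hV; split.
- by apply: bracket_boundedM; [case: hZ|case: hV].
- by case: hZ hV => _ hZ [_ hV] x; apply: cvgM; [exact: hZ|exact: hV].
- by apply: bracket_boundedM; [case: hZ|case: hV].
- have [wZ wV] := (symbolW hZ, symbolW hV).
  case: hZ hV => _ [dZ sZ] [_ [dV sV]].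
  split; first by move=> x; exact: derivableM.
  rewrite derive1M_fun//; apply: symbolD.
    by rewrite addrAC; exact: IH.
  by rewrite -addrA; exact: IH.
Qed.

Lemma symbol_cst0 m s : symbol m s (fun=> 0).
Proof.
have B t : bracket_bounded t (fun=> 0).
  by exists 0 => x; rewrite normr0 mul0r.
elim: m s => [|m IH] s; split => //; first by move=> x; exact: cvg_cst.
split; first by move=> x; exact: derivable_cst.
by rewrite derive1_cst_fun.
Qed.

Lemma symbol_cst m (c : R) : symbol m 0 (fun=> c).
Proof.
have B : bracket_bounded 0 (fun=> c).
  by exists `|c| => x; rewrite bracket0 mulr1.
case: m => [|m]; split => //; first by move=> x; exact: cvg_cst.
split; first by move=> x; exact: derivable_cst.
by rewrite derive1_cst_fun; exact: symbol_cst0.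
Qed.

Lemma symbol_id m : symbol m 1 id.
Proof.
have B : bracket_bounded 1 id.
  by exists 1 => x; rewrite mul1r ler_norm_bracket.
case: m => [|m]; split => //; first by move=> x; exact: cvg_id.
split; first by move=> x; exact: derivable_id.
have -> : id^`()%classic = (fun=> 1) :> (R -> R).
  by apply/funext => x; rewrite derive1_id.
by rewrite subrr; exact: symbol_cst.
Qed.

Lemma symbol_bracket m a : symbol m a (bracket a).
Proof.
have B t : bracket_bounded t (bracket t).
  by exists 1 => x; rewrite mul1r ger0_norm// ltW// bracket_gt0.
elim: m a => [|m IH] a; split => //; first exact: (@bracket_continuous R a).
split; first by move=> x; have [] := is_derive_bracket a x.
have -> : (bracket a)^`()%classic = (fun x => a * (x * bracket (a - 2) x)).
  by apply/funext => x; rewrite derive1E; have [_ ->] := is_derive_bracket a x.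
have -> : a - 1 = 0 + (1 + (a - 2)) by ring.
apply: symbolM; first exact: symbol_cst.
by apply: symbolM; [exact: symbol_id|exact: IH].
Qed.

Lemma symbol_derive1n m s Z :
  (forall n x, (n < m)%N -> derivable Z^`(n)%classic x 1) ->
  continuous Z^`(m)%classic ->
  (forall n, (n <= m)%N -> bracket_bounded (s - n%:R) Z^`(n)%classic) ->
  symbol m s Z.
Proof.
elim: m s Z => [|m IH] s Z dZ cZ bZ.
  by split => //; have := bZ 0%N (leqnn _); rewrite subr0.
have E n : (Z^`())^`(n)%classic = Z^`(n.+1)%classic by rewrite /derive1n iterSr.
split; first by have := bZ 0%N (leq0n _); rewrite subr0.
split; first by move=> x; exact: (dZ 0%N).
apply: IH => [n x nm||n nm]; rewrite E //.
- exact: dZ.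
- by have := bZ n.+1 nm; rewrite -natr1 opprD addrCA addrC.
Qed.

Lemma cvg_symbol (H : set_system R) {FH : Filter H} m s Z : symbol m s Z ->
  bracket s x @[x --> H] --> 0 -> Z x @[x --> H] --> 0.
Proof.
move=> /symbol_bounded[C ZC] H0; apply: norm_cvg0.
apply: (@squeeze_cvgr _ _ _ _ (fun=> 0) (fun x => C * bracket s x)).
- by apply: nearW => x; rewrite normr_ge0 ZC.
- exact: cvg_cst.
- by rewrite -(mulr0 C); apply: cvgM; [exact: cvg_cst|].
Qed.

Lemma rintegrable_symbol m s Z : symbol m s Z -> s < -1 -> rintegrable Z.
Proof.
move=> sZ s1; have [C ZC] := symbol_bounded sZ.
apply: (le_rintegrable (symbol_continuous sZ) _ ZC).
by apply: rintegrableZ; exact: rintegrable_bracket.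
Qed.

End symbol.

(** * The Student density *)

Section student.
Context {R : realType}.
Variable mu : R.
Hypothesis mu_gt0 : 0 < mu.
Notation leb := (@lebesgue_measure R).

Lemma student_weightE : student_weight mu = bracket (- (mu + 1)).
Proof. by apply/funext => x; rewrite /bracket mulNr. Qed.

Lemma rintegrable_student_weight : rintegrable (student_weight mu).
Proof.
rewrite student_weightE; apply: rintegrable_bracket.
by rewrite ltrN2 ltrDr.
Qed.

(** The integral of the weight is the limit at infinity of a function with a
positive derivative and a null limit at minus infinity. *)
Lemma student_const_gt0 : 0 < student_const mu.
Proof.
have iw := rintegrable_student_weight.
have cw : continuous (student_weight mu).
  by rewrite student_weightE; exact: bracket_continuous.
rewrite invr_gt0.
have w0 x : 0 < student_weight mu x by rewrite student_weightE bracket_gt0.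
have := gt0_derive_itv (fun x => is_derive_Rintegral_Ny x iw cw) w0
  (cvg_Rintegral_Ny_y iw) (cvg_Rintegral_Ny_Ny iw) 0.
by move=> /andP[]; exact: lt_trans.
Qed.

Lemma student_density : is_density (student_cdf mu) (student_pdf mu).
Proof.
have c0 := student_const_gt0.
have iw : rintegrable (student_pdf mu).
  by apply: rintegrableZ; exact: rintegrable_student_weight.
have cw : continuous (student_pdf mu).
  move=> x; apply: cvgM; first exact: cvg_cst.
  by rewrite student_weightE; exact: bracket_continuous.
have i1 : \int[leb]_x student_pdf mu x = 1.
  rewrite rintegralZ; last exact: rintegrable_student_weight.
  rewrite mulVf//; apply: contraTneq c0 => w0.
  by rewrite /student_const w0 invr0 ltxx.
split => //.
- by move=> x; rewrite mulr_gt0// student_weightE bracket_gt0.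
- by move=> x; exact: is_derive_Rintegral_Ny.
- exact: cvg_Rintegral_Ny_Ny.
- by rewrite -i1; exact: cvg_Rintegral_Ny_y.
Qed.

Lemma symbol_student_pdf m : symbol m (- (mu + 1)) (student_pdf mu).
Proof.
have := symbolM (symbol_cst m (student_const mu))
  (symbol_bracket m (- (mu + 1))).
by rewrite add0r -student_weightE.
Qed.

(** Differentiation lowers the order by one, and division by the Student density
raises it by [mu + 1]. *)
Lemma symbol_dens_deriv m s (Z : R -> R) : symbol m.+1 s Z ->
  symbol m (s + mu) (dens_deriv (student_pdf mu) Z).
Proof.
case=> _ [_ sZ].
have -> : dens_deriv (student_pdf mu) Z =
    (fun x => Z^`()%classic x * ((student_const mu)^-1 * bracket (mu + 1) x)).
  apply/funext => x; rewrite /dens_deriv /student_pdf student_weightE bracketN.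
  by rewrite invfM; congr (_ * (_ * _)); exact: invrK.
have -> : s + mu = (s - 1) + (0 + (mu + 1)) by ring.
apply: symbolM sZ _; apply: symbolM; first exact: symbol_cst.
exact: symbol_bracket.
Qed.

Lemma symbol_iter_dens_deriv m n s (Z : R -> R) : symbol (n + m) s Z ->
  symbol m (s + n%:R * mu) (iter n (dens_deriv (student_pdf mu)) Z).
Proof.
elim: n m => [|n IH] m sZ; first by rewrite mul0r addr0.
rewrite iterS -natr1 mulrDl mul1r addrA; apply: symbol_dens_deriv.
by apply: IH; rewrite addnS.
Qed.

End student.

(** * Growth at infinity from upper limits *)

Section growth.
Context {R : realType}.
Implicit Types (Z f : R -> R).

Lemma limf_esup_lty (f : R -> R) (H : set_system R) {FH : Filter H} :
  (limf_esup (fun x => (f x)%:E) H < +oo)%E ->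
  exists M : R, \forall x \near H, f x <= M.
Proof.
rewrite limf_esupE => /ereal_inf_lt[_ [A HA <-] supy].
exists (fine (ereal_sup [set (f x)%:E | x in A])).
apply: filterS HA => x Ax.
have fx : ((f x)%:E <= ereal_sup [set (f x)%:E | x in A])%E.
  by apply: ereal_sup_ubound; exists x.
rewrite -lee_fin fineK//.
by move: fx supy; case: (ereal_sup _).
Qed.

Lemma exprz_le_bracket (z : int) : exists2 C : R, 0 <= C &
  forall x : R, 1 <= `|x| -> `|x| ^ z <= C * bracket z%:~R x.
Proof.
have b1 (x : R) := ltW (bracket_gt0 1 x).
case: z => n.
  exists 1 => // x _; rewrite mul1r -pmulrn bracketX.
  by rewrite lerXn2r ?nnegrE ?ler_norm_bracket.
(* for a negative exponent, from [bracket 1 x <= 2 * `|x|] *)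
exists (2 ^+ n.+1) => [|x x1]; first exact: exprn_ge0.
have x0 : 0 < `|x| by lra.
have h : bracket 1 x <= 2 * `|x|.
  rewrite bracket1 -[leRHS]ger0_norm; last by rewrite mulr_ge0.
  rewrite -sqrtr_sqr ler_wsqrtr//.
  rewrite exprMn -normrX (ger0_norm (sqr_ge0 _)).
  rewrite -[x ^+ 2]real_normK ?num_real//.
  by nra.
rewrite NegzE mulrNz bracketN -pmulrn bracketX -exprnN.
rewrite -[leLHS]mul1r ler_pdivrMr ?exprn_gt0// mulrAC.
rewrite ler_pdivlMr ?exprn_gt0 ?bracket_gt0// mul1r -exprMn.
by rewrite lerXn2r ?nnegrE ?mulr_ge0.
Qed.

(** The bounds near the two infinities are completed by the extreme value
theorem on the compact interval in between. *)
Lemma bracket_bounded_limf_esup Z (z : int) : continuous Z ->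
  (limf_esup (fun x : R => (`|Z x| / `|x| ^ z)%:E) (pinfty_nbhs R) < +oo)%E ->
  (limf_esup (fun x : R => (`|Z x| / `|x| ^ z)%:E) (ninfty_nbhs R) < +oo)%E ->
  bracket_bounded z%:~R Z.
Proof.
move=> cZ /limf_esup_lty[M1 h1] /limf_esup_lty[M2 h2].
have [C C0 Cz] := exprz_le_bracket z.
have bd (M x : R) : `|Z x| / `|x| ^ z <= M -> 1 <= `|x| ->
    `|Z x| <= `|M| * C * bracket z%:~R x.
  move=> ZM x1; have x0 : 0 < `|x| by lra.
  rewrite -mulrA; apply: le_trans (ler_wpM2l _ (Cz _ x1)) => //.
  by rewrite -ler_pdivrMr ?exprz_gt0// (le_trans ZM)// ler_norm.
have {h1 h2} [a [h1 h2]] : exists a : R,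
    (forall x, a < x -> `|Z x| <= `|M1| * C * bracket z%:~R x) /\
    (forall x, x < - a -> `|Z x| <= `|M2| * C * bracket z%:~R x).
  move: h1 h2 => [A1 [_ h1]] [A2 [_ h2]].
  exists (`|A1| + `|A2| + 1); split => x hx; apply: bd.
  - by apply: h1; have := ler_norm A1; have := normr_ge0 A2; lra.
  - by rewrite ler_normr; have := normr_ge0 A1; have := normr_ge0 A2; lra.
  - by apply: h2; have := lerNnormlW (lexx `|A2|); have := normr_ge0 A1; lra.
  - by rewrite ler_normr; have := normr_ge0 A1; have := normr_ge0 A2; lra.
have aa : - `|a| <= `|a| by have := normr_ge0 a; lra.
pose h x := `|Z x| * bracket (- z%:~R) x.
have ch : continuous h.
  move=> x; apply: cvgM; first by apply: cvg_norm; exact: cZ.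
  exact: bracket_continuous.
have [c _ hc] := EVT_max aa (continuous_subspaceT ch).
have ZE x : `|Z x| = h x * bracket z%:~R x.
  by rewrite /h bracketN divfK// gt_eqF// bracket_gt0.
have h0 x : 0 <= h x by rewrite mulr_ge0// ltW// bracket_gt0.
have M0 (M : R) : 0 <= `|M| * C by rewrite mulr_ge0.
exists (`|M1| * C + `|M2| * C + h c) => x.
have b0 := ltW (bracket_gt0 z%:~R x).
rewrite !mulrDl.
have m1 := mulr_ge0 (M0 M1) b0; have m2 := mulr_ge0 (M0 M2) b0.
have m3 := mulr_ge0 (h0 c) b0.
have [ax|xa] := ltP a x; first by have := h1 x ax; lra.
have [xa'|ax'] := ltP x (- a); first by have := h2 x xa'; lra.
have : h x <= h c.
  apply: hc; rewrite in_itv/=; have := ler_norm a; lra.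
by move=> /(ler_wpM2r b0); rewrite -ZE; lra.
Qed.

End growth.

(** * Decay of the coefficients *)

Section student_coefficients.
Context {R : realType}.
Notation leb := (@lebesgue_measure R).
Variables (mu q : R) (y : R -> R) (r p : nat).
Hypotheses (mu_gt0 : 0 < mu).
Hypothesis y_smooth : continuously_differentiable r y.
Hypothesis y_growth : forall n, (n <= r)%N ->
  (limf_esup (fun x : R => (`|y^`(n)%classic x| / `|x| ^ (p%:Z - n%:Z))%:E)
     (pinfty_nbhs R) < +oo)%E /\
  (limf_esup (fun x : R => (`|y^`(n)%classic x| / `|x| ^ (p%:Z - n%:Z))%:E)
     (ninfty_nbhs R) < +oo)%E.
Hypothesis q_large : p%:R + (r%:R - 1 / 2) * mu < q.
Notation w := (student_pdf mu).
Notation D := (dens_deriv w).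
Let Y := damped q y.
Let Fw := student_density mu_gt0.

Lemma symbol_damped : symbol r (p%:R - q) Y.
Proof.
have [dy cy] := y_smooth.
have cyn n : (n <= r)%N -> continuous y^`(n)%classic.
  rewrite leq_eqVlt => /predU1P[->//|nr].
  by apply: derivable_continuous => x; exact: dy.
have -> : Y = (fun x => y x * bracket (- q) x).
  by apply/funext => x; rewrite bracketN.
apply: symbolM; last exact: symbol_bracket.
apply: symbol_derive1n => [n x nr||n nr]; [exact: dy|exact: cy|].
have [gy gNy] := y_growth nr.
have := bracket_bounded_limf_esup (cyn _ nr) gy gNy.
by rewrite intrB -!pmulrn.
Qed.

Lemma symbol_iter_damped n : (n <= r)%N ->
  symbol (r - n) (p%:R - q + n%:R * mu) (iter n D Y).
Proof.
move=> nr; apply: symbol_iter_dens_deriv; rewrite subnKC//.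
exact: symbol_damped.
Qed.

Lemma continuous_iter_damped n : (n <= r)%N -> continuous (iter n D Y).
Proof. by move=> /symbol_iter_damped/symbol_continuous. Qed.

Lemma derivable_iter_damped n x : (n < r)%N -> derivable (iter n D Y) x 1.
Proof.
move=> nr; have := symbol_iter_damped (ltnW nr).
by rewrite -(subnSK nr) => -[_ []].
Qed.

(** The integrand has order [2 * (p - q + n * mu) - (mu + 1)], which is below
[-1] exactly when [p + (n - 1 / 2) * mu < q]. *)
Lemma rintegrable_sqr_iter_damped n : (n <= r)%N ->
  rintegrable (fun x => iter n D Y x ^+ 2 * w x).
Proof.
move=> nr; have sD := symbol_iter_damped nr.
have s0 := symbolM (symbolM sD sD) (symbol_student_pdf mu (r - n)).
apply: (rintegrable_symbol s0).
have : n%:R * mu <= r%:R * mu by rewrite ler_wpM2r ?(ltW mu_gt0)// ler_nat.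
move: q_large mu_gt0; lra.
Qed.

(** For [n < r] the [n]-th derivative vanishes at infinity, which cancels the
boundary terms of the integrations by parts. *)
Lemma iter_damped_order_lt0 n : (n < r)%N -> p%:R - q + n%:R * mu < 0.
Proof.
move=> nr.
have : n.+1%:R * mu <= r%:R * mu by rewrite ler_wpM2r ?(ltW mu_gt0)// ler_nat.
rewrite -natr1; move: q_large mu_gt0; lra.
Qed.

Let I := \int[leb]_x (iter r D Y x ^+ 2 * w x).

Lemma tail_constE :
  tail_const r (damped_unit mu q y) = ((pi ^+ (2 * r))^-1 * I)%:E.
Proof.
rewrite /tail_const EFinM; congr (_ * _)%E.
have := integral_derive1n_quantile Fw
  (fun m x mr => @derivable_iter_damped m x mr)
  (continuous_iter_damped (leqnn r)).
move=> ->; rewrite /I /Rintegral fineK//.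
by apply: integrable_fin_num => //; exact: rintegrable_sqr_iter_damped.
Qed.

Lemma coefE k : (0 < k)%N -> coef mu q y k =
  (- (k%:R * pi)^-1) ^+ r *
    \int[leb]_x (iter r D Y x * psi (student_cdf mu) r k x * w x).
Proof.
move=> k0; rewrite -(@Rintegral_psi_iter _ _ _ Fw)//.
- apply: eq_rintegral => x; congr (_ * _ * _).
  by rewrite /phi gtn_eqF// /psi mul0r subr0.
- by move=> n x; exact: derivable_iter_damped.
- exact: continuous_iter_damped.
- exact: rintegrable_sqr_iter_damped.
- move=> n nr; apply: (cvg_symbol (symbol_iter_damped (ltnW nr))).
  exact/cvg_bracketNy/iter_damped_order_lt0.
- move=> n nr; apply: (cvg_symbol (symbol_iter_damped (ltnW nr))).
  exact/cvg_brackety/iter_damped_order_lt0.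
Qed.

(** The [k]-th coefficient is, up to sign, [(k * pi)^-r] times that of the
[r]-th derivative, and [K.+1 <= k]. *)
Lemma sqr_coef_le K k : (K < k)%N -> `|coef mu q y k| ^+ 2 <=
  (pi ^+ (2 * r))^-1 * (K.+1%:R ^+ (2 * r))^-1 *
  (\int[leb]_x (iter r D Y x * psi (student_cdf mu) r k x * w x)) ^+ 2.
Proof.
move=> Kk; have k0 : (0 < k)%N := leq_ltn_trans (leq0n K) Kk.
rewrite coefE// real_normK ?num_real// exprMn ler_wpM2r ?sqr_ge0//.
rewrite -exprM mulnC exprM sqrrN -exprM exprVn exprMn invfM mulrC.
rewrite ler_wpM2l ?invr_ge0 ?exprn_ge0 ?pi_ge0//.
by rewrite lef_pV2 ?posrE ?exprn_gt0 ?ltr0n// lerXn2r ?nnegrE// ler_nat.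
Qed.

Lemma sum_sqr_coef_le K n : \sum_(K.+1 <= k < n) `|coef mu q y k| ^+ 2 <=
  (pi ^+ (2 * r))^-1 * I * (K.+1%:R ^+ (2 * r))^-1.
Proof.
set c := (pi ^+ (2 * r))^-1 * (K.+1%:R ^+ (2 * r))^-1 : R.
have c0 : 0 <= c by rewrite mulr_ge0 ?invr_ge0 ?exprn_ge0 ?pi_ge0.
rewrite mulrAC -/c.
have := @bessel_inequality _ _ _ Fw r K n _ (continuous_iter_damped (leqnn r))
  (rintegrable_sqr_iter_damped (leqnn r)).
move=> /(ler_wpM2l c0); apply: le_trans.
rewrite mulr_sumr big_nat [leRHS]big_nat; apply: ler_sum => k /andP[Kk _].
exact: sqr_coef_le.
Qed.

End student_coefficients.

Theorem proposition3 (R : realType)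
    (d : measure_display) (Omega : measurableType d) (P : probability Omega R)
    (T : R) (N dW : nat)
    (W : R -> Omega -> 'cV[R]_dW)
    (b : R -> R -> R) (sigma : R -> R -> 'rV[R]_dW)
    (g : R -> R) (f : R -> R -> R -> R)
    (Cg etag Lf Cf etaf : R)
    (y : nat -> R -> R)
    (mu q : R) (i r p : nat)
    (T_gt0 : 0 < T) (N_ge1 : (1 <= N)%N)
    (W_bm : brownian_motion P T W)
    (b_meas : measurable_fun (`[0, T] `*` [set: R])
       (fun z : R * R => b z.1 z.2))
    (b_bnd : exists M : R, forall t x, 0 <= t <= T -> `|b t x| <= M)
    (sigma_meas : forall k : 'I_dW, measurable_fun (`[0, T] `*` [set: R])
       (fun z : R * R => sigma z.1 z.2 ord0 k))
    (sigma_bnd : exists M : R, forall t x (k : 'I_dW),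
       0 <= t <= T -> `|sigma t x ord0 k| <= M)
    (Cg_ge0 : 0 <= Cg) (etag_ge0 : 0 <= etag) (Lf_ge0 : 0 <= Lf)
    (Cf_ge0 : 0 <= Cf) (etaf_ge0 : 0 <= etaf)
    (g_meas : measurable_fun [set: R] g)
    (g_bnd : forall x, `|g x| <= Cg * (1 + `|x| ^+ 2) `^ (etag / 2))
    (f_meas : forall j, (j < N)%N ->
       measurable_fun [set: R * R] (fun z : R * R => f (time T N j) z.1 z.2))
    (f_lip : forall j x y1 y2, (j < N)%N ->
       `|f (time T N j) x y1 - f (time T N j) x y2| <= Lf * `|y1 - y2|)
    (f_bnd : forall j x, (j < N)%N ->
       `|f (time T N j) x 0| <= Cf * (1 + `|x| ^+ 2) `^ (etaf / 2))
    (y_value : value_functions P T N b sigma W g f y)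
    (mu_gt0 : 0 < mu) (q_ge0 : 0 <= q) (i_le : (i <= N)%N) (r_ge1 : (1 <= r)%N)
    (y_smooth : continuously_differentiable r (y i))
    (y_growth : forall n, (n <= r)%N ->
       (limf_esup (fun x : R => (`|(y i)^`(n)%classic x| / `|x| ^ (p%:Z - n%:Z))%:E)
          (pinfty_nbhs R) < +oo)%E /\
       (limf_esup (fun x : R => (`|(y i)^`(n)%classic x| / `|x| ^ (p%:Z - n%:Z))%:E)
          (ninfty_nbhs R) < +oo)%E)
    (q_large : p%:R + (r%:R - 1 / 2) * mu < q) :
  let C := tail_const r (damped_unit mu q (y i)) in
  (C < +oo)%E /\
  forall K : nat,
    (\sum_(K.+1 <= k <oo) (`|coef mu q (y i) k| ^+ 2)%:E
       <= C * ((K.+1%:R ^+ (2 * r))^-1)%:E)%E.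
Proof.
move=> C; have CE := tail_constE mu_gt0 y_smooth y_growth q_large.
split; first by rewrite /C CE ltry.
move=> K; rewrite /C CE -EFinM.
apply: lime_le.
  by apply: is_cvg_nneseries => k _ _; rewrite lee_fin sqr_ge0.
apply: nearW => n; rewrite sumEFin lee_fin.
exact: (sum_sqr_coef_le mu_gt0 y_smooth y_growth q_large).
Qed.
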